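(* For every positive integer $n$ there exist a positive integer $x_1$ and a positive integer $m$ such that for every $i \in \{0,1,\dots,n-1\}$ we have $Col^{i+1}(x_1) < Col^{i}(x_1)$ and the step size of $Col^{i}(x_1)$ equals $m$.
   Context: The Collatz map $Col$ on the positive integers is defined as follows. If $x$ is odd, $Col(x) = (3x+1)/2^{m}$, where $m \ge 1$ is the exponent of the largest power of $2$ dividing $3x+1$; if $x$ is even, $Col(x) = x/2^{m}$, where $m \ge 1$ is the exponent of the largest power of $2$ dividing $x$. In either case this exponent $m$ is called the step size of $x$. $Col^{0}(x) = x$ and $Col^{i+1}(x) = Col(Col^{i}(x))$. *)

(* Defs.v *)
From mathcomp Require Import all_boot.

Set Implicit Arguments.
Unset Strict Implicit.
Unset Printing Implicit Defensive.

(* The Collatz map is meant on positive integers; [0] carries the junk values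
   [step_size 0 = 0] and [Col 0 = 0]. *)

Definition Col_num (x : nat) : nat := if odd x then 3 * x + 1 else x.

(* For a positive argument, [logn 2] is the exponent of the largest power of 2
   dividing it. *)
Definition step_size (x : nat) : nat := logn 2 (Col_num x).

Definition Col (x : nat) : nat := Col_num x %/ 2 ^ step_size x.

Lemma Col_num_gt0 (x : nat) : 0 < x -> 0 < Col_num x.
Proof. by rewrite /Col_num; case: odd => //; rewrite addn1. Qed.

Lemma step_size_gt0 (x : nat) : 0 < x -> 0 < step_size x.
Proof.
move=> x0; rewrite /step_size logn_gt0 mem_primes Col_num_gt0 //= dvdn2 /Col_num.
by case: ifP => [ox | ->//]; rewrite oddD oddM ox.
Qed.

Lemma Col_gt0 (x : nat) : 0 < x -> 0 < Col x.
Proof.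
move=> x0; have c0 := Col_num_gt0 x0.
by rewrite divn_gt0 ?expn_gt0 // dvdn_leq // pfactor_dvdnn.
Qed.

(* Main.v *)
Require Import Defs.
From mathcomp Require Import all_boot.
From mathcomp Require Import zify.

(* On odd x with step size 2 the map is x |-> (3x + 1)/4, an affine contraction
   fixing 1, so x = 1 + y goes to 1 + 3y/4. If y is divisible by a high power of
   4, then the step size stays 2 and the orbit keeps decreasing towards 1. *)

Lemma Col_num_8n1 (c : nat) : Col_num (8 * c + 1) = 2 ^ 2 * (6 * c + 1).
Proof. by rewrite /Col_num oddD oddM /=; lia. Qed.

(** The modulus is 8 because for [x = 4 * d + 1] the number [3 * x + 1 = 4 * (3 * d + 1)] has an odd
    cofactor only when [d] is even. *)
Lemma step_size_8n1 (c : nat) : step_size (8 * c + 1) = 2.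
Proof.
rewrite /step_size Col_num_8n1 lognM ?addn1 // pfactorK //.
by rewrite lognE dvdn2 /= oddM.
Qed.

Lemma Col_8n1 (c : nat) : Col (8 * c + 1) = 6 * c + 1.
Proof. by rewrite /Col step_size_8n1 Col_num_8n1 mulKn. Qed.

(** Each step trades one factor 4 of [x - 1] for a factor 3, which the induction absorbs into [c];
    the factor 2 survives and keeps the form [8 * _ + 1] while a 4 is left. *)
Lemma iter_Col (i c : nat) :
  iter i Col (2 * 4 ^ i * c + 1) = 2 * 3 ^ i * c + 1.
Proof.
elim: i c => [|i IHi] c //.
have -> : 2 * 4 ^ i.+1 * c = 8 * (4 ^ i * c) by rewrite expnS; lia.
rewrite iterSr Col_8n1.
have -> : 6 * (4 ^ i * c) = 2 * 4 ^ i * (3 * c) by lia.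
by rewrite IHi expnS; lia.
Qed.

Theorem theorem2 (n : nat) (n_gt0 : 0 < n) :
  exists x1 m : nat,
    [/\ 0 < x1, 0 < m &
      forall i : nat, i < n ->
        iter i.+1 Col x1 < iter i Col x1 /\ step_size (iter i Col x1) = m].
Proof.
exists (2 * 4 ^ n + 1), 2; split=> // [|i lt_in]; first by rewrite addn1.
(* After [i < n] steps [x - 1] is [2 * 3 ^ i * 4 ^ (n - i)]; one remaining 4 joins the 2 to give the
   8. *)
pose c := 3 ^ i * 4 ^ (n - i.+1).
have itE : iter i Col (2 * 4 ^ n + 1) = 8 * c + 1.
  rewrite -(subnKC (ltnW lt_in)) expnD mulnA iter_Col.
  by rewrite -subnSK // expnS /c; lia.
rewrite iterS itE Col_8n1 step_size_8n1; split=> //.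
by rewrite ltn_add2r ltn_pmul2r // muln_gt0 !expn_gt0.
Qed.
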